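(* Let $(R,\mathfrak m)$ be a Noetherian local ring and let $\mathfrak p,\mathfrak q\in\operatorname{Spec}(R)$ be such that $\mathfrak p\in V(\mathfrak q)$ (i.e. $\mathfrak q\subseteq\mathfrak p$). Then $E_R(R/\mathfrak q)^\vee$ is a flat precover of $(R/\mathfrak q)^\vee$, where $M^\vee:=\operatorname{Hom}_R(M,E_R(R/\mathfrak p))$ for an $R$-module $M$.
   Context: For an $R$-module $N$, $E_R(N)$ denotes an injective hull of $N$ over $R$. A flat precover of an $R$-module $M$ is a flat $R$-module $F$ together with an $R$-linear map $\phi:F\to M$ such that for every flat $R$-module $G$ the induced map $\operatorname{Hom}_R(G,F)\to\operatorname{Hom}_R(G,M)$, $g\mapsto\phi\circ g$, is surjective; one says that $F$ is a flat precover of $M$ if such a $\phi$ exists. *)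

(* Defs.v *)
From HB Require Import structures.
From mathcomp Require Import all_boot all_algebra.
From mathcomp Require Import finmap boolp monalg.

Set Implicit Arguments.
Unset Strict Implicit.
Unset Printing Implicit Defensive.

Import GRing.Theory.

Local Open Scope ring_scope.
Local Open Scope quotient_scope.

(* Ideals are boolean predicates; since boolp makes every proposition
   decidable, this is no restriction. An [idealr R] is a proper ideal. *)

Definition noetherian (R : comNzRingType) : Prop :=
  forall I : {pred R^o}, submod_closed I ->
    exists s : seq R, forall x : R,
      x \in I <-> exists c : 'I_(size s) -> R, x = \sum_i c i * s`_i.

Definition maximal_ideal (R : comNzRingType) (I : idealr R) : Prop :=
  forall J : idealr R, {subset I <= J} -> J =i I.

Definition local_ring (R : comNzRingType) (m : idealr R) : Prop :=
  maximal_ideal m /\ forall I : idealr R, maximal_ideal I -> I =i m.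

Section IdealQuotient.
Variables (R : comNzRingType) (I : idealr R).

Definition idealq_scale (a : R) (x : {ideal_quot I}) : {ideal_quot I} :=
  \pi_{ideal_quot I} a * x.

Lemma idealq_scaleA a b x :
  idealq_scale a (idealq_scale b x) = idealq_scale (a * b) x.
Proof. by rewrite /idealq_scale rmorphM mulrA. Qed.

Lemma idealq_scale1 : left_id 1 idealq_scale.
Proof. by move=> x; rewrite /idealq_scale rmorph1 mul1r. Qed.

Lemma idealq_scaleDr : right_distributive idealq_scale +%R.
Proof. by move=> a x y; rewrite /idealq_scale mulrDr. Qed.

Lemma idealq_scaleDl x : {morph idealq_scale^~ x : a b / a + b}.
Proof. by move=> a b; rewrite /idealq_scale rmorphD mulrDl. Qed.

HB.instance Definition _ := GRing.Zmodule_isLmodule.Build R {ideal_quot I}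
  idealq_scaleA idealq_scale1 idealq_scaleDr idealq_scaleDl.

End IdealQuotient.

Section Hom.
Variables (R : comNzRingType) (M N : lmodType R).
Implicit Types (f g h : {linear M -> N}) (a b : R).

Lemma linear_ext f g : f =1 g -> f = g.
Proof.
case: f g => [f [[fD] [fZ]]] [g [[gD] [gZ]]] /= /funext efg; subst g.
by rewrite (Prop_irrelevance fD gD) (Prop_irrelevance fZ gZ).
Qed.

HB.instance Definition _ := gen_eqMixin {linear M -> N}.
HB.instance Definition _ := gen_choiceMixin {linear M -> N}.

Definition hom_zero : {linear M -> N} := \0.
Definition hom_opp f : {linear M -> N} := \- f.
Definition hom_add f g : {linear M -> N} := f \+ g.
Definition hom_scale a f : {linear M -> N} := a \*: f.

Lemma hom_addA : associative hom_add.
Proof. by move=> f g h; apply: linear_ext => x /=; rewrite addrA. Qed.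

Lemma hom_addC : commutative hom_add.
Proof. by move=> f g; apply: linear_ext => x /=; rewrite addrC. Qed.

Lemma hom_add0 : left_id hom_zero hom_add.
Proof. by move=> f; apply: linear_ext => x /=; rewrite add0r. Qed.

Lemma hom_addN : left_inverse hom_zero hom_opp hom_add.
Proof. by move=> f; apply: linear_ext => x /=; rewrite addNr. Qed.

HB.instance Definition _ := GRing.isZmodule.Build {linear M -> N}
  hom_addA hom_addC hom_add0 hom_addN.

Lemma hom_scaleA a b f : hom_scale a (hom_scale b f) = hom_scale (a * b) f.
Proof. by apply: linear_ext => x /=; rewrite scalerA. Qed.

Lemma hom_scale1 : left_id 1 hom_scale.
Proof. by move=> f; apply: linear_ext => x /=; rewrite scale1r. Qed.

Lemma hom_scaleDr : right_distributive hom_scale +%R.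
Proof. by move=> a f g; apply: linear_ext => x /=; rewrite scalerDr. Qed.

Lemma hom_scaleDl f : {morph hom_scale^~ f : a b / a + b}.
Proof. by move=> a b; apply: linear_ext => x /=; rewrite scalerDl. Qed.

HB.instance Definition _ := GRing.Zmodule_isLmodule.Build R {linear M -> N}
  hom_scaleA hom_scale1 hom_scaleDr hom_scaleDl.

End Hom.

(* The tensor product is the free module on M * N modulo the submodule
   generated by the bilinearity relations. *)
Section Tensor.
Variables (R : comNzRingType) (M N : lmodType R).

Local Notation freeMN := {malg R[(M * N)%type]}.

Definition tensor_rel : pred freeMN := fun t =>
  `[< forall S : {pred freeMN}, submod_closed S ->
      (forall a x x' y,
         << (a *: x + x', y) >> - (a *: << (x, y) >> + << (x', y) >>) \in S) ->
      (forall a x y y',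
         << (x, a *: y + y') >> - (a *: << (x, y) >> + << (x, y') >>) \in S) ->
      t \in S >].

Lemma tensor_relP : submod_closed tensor_rel.
Proof.
split; first by apply/asboolP => S [].
move=> a u v /asboolP uR /asboolP vR; apply/asboolP => S SS S1 S2.
by case: (SS) => _; apply; [apply: uR | apply: vR].
Qed.

HB.instance Definition _ :=
  GRing.isZmodClosed.Build freeMN tensor_rel (GRing.submod_closedB tensor_relP).

Definition tensor_relZ : zmodClosed freeMN :=
  GRing.ZmodClosed.clone freeMN tensor_rel _.

Definition tensor : Type := Quotient.quot tensor_relZ.
HB.instance Definition _ := GRing.Zmodule.on tensor.

Definition tensor_pi (t : freeMN) : tensor := \pi_(Quotient.quot tensor_relZ) t.
Definition tensor_repr (u : tensor) : freeMN :=
  repr (u : Quotient.quot tensor_relZ).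

Lemma tensor_reprK : cancel tensor_repr tensor_pi.
Proof. exact: reprK. Qed.

Lemma tensor_piD : {morph tensor_pi : s t / s + t}.
Proof. by move=> s t; rewrite /tensor_pi raddfD. Qed.

Lemma tensor_piP s t : tensor_pi s = tensor_pi t <-> s - t \in tensor_rel.
Proof.
have E : (s - t \in tensor_rel) = (tensor_pi s == tensor_pi t).
  exact: (Quotient.idealrBE tensor_relZ s t).
by rewrite E; split=> [->|/eqP].
Qed.

Definition tensor_scale (a : R) (u : tensor) : tensor :=
  tensor_pi (a *: tensor_repr u).

Lemma tensor_piZ a t : tensor_pi (a *: t) = tensor_scale a (tensor_pi t).
Proof.
apply/tensor_piP; rewrite -scalerBr.
have [_ ZR] := GRing.submod_closed_semi tensor_relP; apply: ZR.
by apply/tensor_piP; rewrite tensor_reprK.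
Qed.

Lemma tensor_scaleA a b u :
  tensor_scale a (tensor_scale b u) = tensor_scale (a * b) u.
Proof. by rewrite -[u]tensor_reprK -!tensor_piZ scalerA. Qed.

Lemma tensor_scale1 : left_id 1 tensor_scale.
Proof. by move=> u; rewrite -[u]tensor_reprK -tensor_piZ scale1r. Qed.

Lemma tensor_scaleDr : right_distributive tensor_scale +%R.
Proof.
move=> a u v; rewrite -[u]tensor_reprK -[v]tensor_reprK.
by rewrite -tensor_piD -!tensor_piZ -tensor_piD scalerDr.
Qed.

Lemma tensor_scaleDl u : {morph tensor_scale^~ u : a b / a + b}.
Proof.
move=> a b; rewrite -[u]tensor_reprK.
by rewrite -!tensor_piZ -tensor_piD scalerDl.
Qed.

HB.instance Definition _ := GRing.Zmodule_isLmodule.Build R tensor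
  tensor_scaleA tensor_scale1 tensor_scaleDr tensor_scaleDl.

Definition tens (x : M) (y : N) : tensor := tensor_pi << (x, y) >>.

Lemma tens_linearl y : linear (tens^~ y).
Proof.
move=> a x x'; rewrite /tens -[a *: tensor_pi _]tensor_piZ -tensor_piD.
by apply/tensor_piP/asboolP => S _ S1 _; apply: S1.
Qed.

Lemma tens_linearr x : linear (tens x).
Proof.
move=> a y y'; rewrite /tens -[a *: tensor_pi _]tensor_piZ -tensor_piD.
by apply/tensor_piP/asboolP => S _ _ S2; apply: S2.
Qed.

Lemma tensZl a x y : tens (a *: x) y = a *: tens x y.
Proof.
have t0 : tens 0 y = 0.
  have := tens_linearl y (-1) 0 0.
  by rewrite scaler0 addr0 scaleN1r addNr.
by have := tens_linearl y a x 0; rewrite t0 !addr0.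
Qed.

Lemma tensorE (u : tensor) : exists s : seq (M * N)%type,
  u = \sum_(z <- s) tens z.1 z.2.
Proof.
rewrite -[u]tensor_reprK; set t := tensor_repr u.
exists [seq (t@_k *: k.1, k.2) | k <- msupp t].
rewrite {1}(monalgE t) big_map (big_morph _ tensor_piD (id1 := 0)); last first.
  by rewrite /tensor_pi raddf0.
apply: eq_bigr => -[x y] _; rewrite tensZl -[_ *: _]tensor_piZ.
congr tensor_pi; apply/malgP => k.
by rewrite mcoeffZ !mcoeffU mulrnAr mulr1.
Qed.

Section Lift.
Variables (P : lmodType R) (b : M -> N -> P).
Hypotheses (bl : forall y, linear (b^~ y)) (br : forall x, linear (b x)).

Definition free_lift (t : freeMN) : P :=
  \sum_(k <- msupp t) t@_k *: b k.1 k.2.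

Lemma free_liftE (d : {fset (M * N)%type}) t : (msupp t `<=` d)%fset ->
  free_lift t = \sum_(k <- d) t@_k *: b k.1 k.2.
Proof.
move=> sub; rewrite /free_lift (big_fset_incl _ sub) // => k _ kt.
by rewrite mcoeff_outdom // scale0r.
Qed.

Lemma free_lift_linear : linear free_lift.
Proof.
move=> a s t; pose d := (msupp (a *: s + t) `|` (msupp s `|` msupp t))%fset.
have h1 : (msupp (a *: s + t) `<=` d)%fset by exact: fsubsetUl.
have h2 : (msupp s `<=` d)%fset by rewrite /d fsetUA fsetUAC fsubsetUr.
have h3 : (msupp t `<=` d)%fset by rewrite /d fsetUA fsubsetUr.
rewrite (free_liftE h1) (free_liftE h2) (free_liftE h3) scaler_sumr.
rewrite -big_split; apply: eq_bigr => k _ /=.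
by rewrite mcoeffD mcoeffZ scalerDl scalerA.
Qed.

Lemma free_liftU x y : free_lift << (x, y) >> = b x y.
Proof. by rewrite /free_lift msuppU oner_eq0 big_seq_fset1 mcoeffUU scale1r. Qed.

Definition tensor_lift_fun (u : tensor) : P := free_lift (tensor_repr u).

Let fl0 : free_lift 0 = 0.
Proof. by rewrite /free_lift msupp0 big_seq_fset0. Qed.

Lemma tensor_lift_pi t : tensor_lift_fun (tensor_pi t) = free_lift t.
Proof.
rewrite /tensor_lift_fun; set s := tensor_repr _.
have /tensor_piP/asboolP st : tensor_pi s = tensor_pi t.
  by rewrite tensor_reprK.
apply/eqP; rewrite -subr_eq0.
have flB v w : free_lift (v - w) = free_lift v - free_lift w.
  by rewrite addrC -(scaleN1r w) free_lift_linear scaleN1r addrC.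
rewrite -flB; apply: (st [pred w | free_lift w == 0]).
- split; first by rewrite inE fl0.
  move=> a v w; rewrite !inE => /eqP v0 /eqP w0.
  by rewrite free_lift_linear v0 w0 scaler0 addr0.
- move=> a x x' y; rewrite inE flB free_lift_linear !free_liftU bl.
  by rewrite subrr.
- move=> a x y y'; rewrite inE flB free_lift_linear !free_liftU br.
  by rewrite subrr.
Qed.

Lemma tensor_lift_linear : linear tensor_lift_fun.
Proof.
move=> a u v; rewrite -[u]tensor_reprK -[v]tensor_reprK.
rewrite -[a *: tensor_pi _]tensor_piZ -tensor_piD !tensor_lift_pi.
exact: free_lift_linear.
Qed.

Definition tensor_lift : {linear tensor -> P} :=
  HB.pack tensor_lift_fun
    (GRing.isLinear.Build R tensor P *:%R tensor_lift_fun tensor_lift_linear).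

Lemma tensor_liftE x y : tensor_lift (tens x y) = b x y.
Proof. by rewrite /= tensor_lift_pi free_liftU. Qed.

End Lift.
End Tensor.

Section TensorMap.
Variables (R : comNzRingType) (M M' N N' : lmodType R).
Variables (f : {linear M -> M'}) (g : {linear N -> N'}).

Lemma tensor_map_linearl y : linear (fun x => tens (f x) (g y)).
Proof. by move=> a x x'; rewrite linearP tens_linearl. Qed.

Lemma tensor_map_linearr x : linear (fun y => tens (f x) (g y)).
Proof. by move=> a y y'; rewrite linearP tens_linearr. Qed.

Definition tensor_map : {linear tensor M N -> tensor M' N'} :=
  tensor_lift tensor_map_linearl tensor_map_linearr.

Lemma tensor_mapE x y : tensor_map (tens x y) = tens (f x) (g y).
Proof. exact: tensor_liftE. Qed.

End TensorMap.

Definition flat (R : comNzRingType) (F : lmodType R) : Prop :=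
  forall (A B : lmodType R) (f : {linear A -> B}),
    injective f -> injective (tensor_map f (@idfun F)).

Definition injective_module (R : comNzRingType) (E : lmodType R) : Prop :=
  forall (A B : lmodType R) (f : {linear A -> B}) (g : {linear A -> E}),
    injective f -> exists h : {linear B -> E}, h \o f =1 g.

Definition essential (R : comNzRingType) (N E : lmodType R)
    (i : {linear N -> E}) : Prop :=
  forall S : {pred E}, submod_closed S ->
    (exists2 e, e \in S & e != 0) -> exists2 n, i n \in S & i n != 0.

Definition injective_hull (R : comNzRingType) (N E : lmodType R)
    (i : {linear N -> E}) : Prop :=
  [/\ injective i, injective_module E & essential i].

Definition is_flat_precover (R : comNzRingType) (F M : lmodType R)
    (phi : {linear F -> M}) : Prop :=
  flat F /\
  forall G : lmodType R, flat G ->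
    forall h : {linear G -> M}, exists g : {linear G -> F}, phi \o g =1 h.

Definition flat_precover_of (R : comNzRingType) (F M : lmodType R) : Prop :=
  exists phi : {linear F -> M}, is_flat_precover phi.

Definition dual (R : comNzRingType) (E M : lmodType R) : lmodType R :=
  {linear M -> E}.

(* Main.v *)
Require Import Defs.
From HB Require Import structures.
From mathcomp Require Import all_boot all_algebra.
From mathcomp Require Import boolp.

(** Write N = R/q, E = E(R/q), E' = E(R/p) and M^v = Hom(M, E'). The map
    E^v -> N^v that does the job is restriction along the inclusion N -> E.

    It has the lifting property for a flat module G by adjunction: a map
    G -> N^v is the same as a map N (x) G -> E'; flatness of G makes
    N (x) G -> E (x) G injective, injectivity of E' extends the map to
    E (x) G, and the extension is a map G -> E^v ([flat_extend_hom]).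

    It remains to see that Hom(E, E') is flat when E and E' are injective over
    a Noetherian ring ([flat_hom_injective]). Let A -> B be injective and let
    u, the sum of the x_k (x) f_k, be an element of A (x) Hom(E, E') that dies
    in B (x) Hom(E, E'). Evaluation sends t (x) f and h' : B -> E to f (h' t),
    so the sum of the f_k (h' x_k) vanishes for every h' : B -> E, and hence
    for every h : A -> E, because h extends to B. As R is Noetherian, the
    linear relations between the x_k are the row combinations of a finite
    matrix C ([noetherian_submod_row]). A vector e of E^n killed by C
    satisfies all these relations, so it has the form (h x_k)_k by injectivity
    of E. Thus (f_k) : E^n -> E' vanishes on the kernel of C : E^n -> E^m and,
    E' being injective, factors through C; that is, f_k is the sum of the
    C_jk g_j ([hom_injective_relation]). Moving the coefficients across the
    tensor product, u becomes the sum over j of (sum_k C_jk x_k) (x) g_j,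
    which is zero. *)

Set Implicit Arguments.
Unset Strict Implicit.
Unset Printing Implicit Defensive.

Import GRing.Theory.
Local Open Scope ring_scope.

(** * Maps into injective modules *)

Definition linear_of (R : comNzRingType) (U V : lmodType R) (f : U -> V)
    (f_linear : linear f) : {linear U -> V} :=
  HB.pack f (GRing.isLinear.Build R U V *:%R f f_linear).

Section Image.
Variables (R : comNzRingType) (M B : lmodType R) (a : {linear M -> B}).

Definition image_pred : {pred B} := fun b => `[< exists x, a x = b >].

Lemma image_pred_submod : submod_closed image_pred.
Proof.
split; first by apply/asboolP; exists 0; rewrite raddf0.
move=> c _ _ /asboolP[x <-] /asboolP[y <-].
by apply/asboolP; exists (c *: x + y); rewrite linearP.
Qed.

HB.instance Definition _ :=
  GRing.isSubmodClosed.Build R B image_pred image_pred_submod.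

(** Injectivity quantifies over modules given as types, so the image has to be
    one, not only a predicate on [B]. *)
Record image := Image { image_val :> B; _ : image_val \in image_pred }.
HB.instance Definition _ := [isSub for image_val].
HB.instance Definition _ := [Choice of image by <:].
HB.instance Definition _ := [SubChoice_isSubLmodule of image by <:].

End Image.

(** The map that [b] induces on the image of [a] extends to all of [B]. With
    [a] a matrix acting on tuples, the lemma trades an inclusion of solution
    sets for a factorization. *)
Lemma injective_module_factor (R : comNzRingType) (M B E : lmodType R)
    (a : {linear M -> B}) (b : {linear M -> E}) :
  injective_module E -> (forall x, a x = 0 -> b x = 0) ->
  exists h : {linear B -> E}, h \o a =1 b.
Proof.
move=> injE ker_ab.
have im_ex (y : image a) : exists x, a x = val y by apply/asboolP/(valP y).
pose r y := projT1 (cid (im_ex y)).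
have rK y : a (r y) = val y by rewrite /r; case: cid.
have b_eq x x' : a x = a x' -> b x = b x'.
  move=> eq_a; apply/eqP; rewrite -subr_eq0 -linearB.
  by rewrite ker_ab // linearB eq_a subrr.
have br_linear : linear (b \o r).
  move=> c y y' /=; rewrite -linearP; apply: b_eq.
  by rewrite linearP !rK linearP.
have [h hE] := injE _ _ (val : {linear image a -> B}) (linear_of br_linear)
  val_inj.
exists h => x /=.
have ax_im : a x \in image_pred a by apply/asboolP; exists x.
have /= -> := hE (Image ax_im).
by apply: b_eq; rewrite rK.
Qed.

(** * Finite generation of submodules of free modules *)

(** Induction on the rank, separating off the first coordinate: the ideal of
    first coordinates is generated by finitely many of them, which lift to
    vectors of [K], and the vectors of [K] with first coordinate zero form a
    submodule of rank one less. *)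
Lemma noetherian_submod_row (R : comNzRingType) (n : nat)
    (K : {pred 'rV[R]_n}) :
  noetherian R -> submod_closed K ->
  exists m (C : 'M[R]_(m, n)), forall x, x \in K <-> exists r, x = r *m C.
Proof.
move=> noeR; elim: n K => [|n IHn]; last rewrite -[n.+1]add1n; move=> K [K0 KL].
  exists 0, 0 => x; split=> [_|_]; last by rewrite (thinmx0 x) -(thinmx0 0).
  by exists 0; rewrite (thinmx0 x) (thinmx0 (_ *m _)).
have KD x y : x \in K -> y \in K -> x + y \in K.
  by rewrite -{2}[x]scale1r; apply: KL.
have KZ c x : x \in K -> c *: x \in K.
  by rewrite -[c *: x]addr0 => /KL; apply.
have Kmul k (D : 'M_(k, 1 + n)) r : (forall i, row i D \in K) -> r *m D \in K.
  move=> DK; rewrite mulmx_sum_row; elim/big_rec: _ => // i x _ xK.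
  by apply: KD => //; apply: KZ.
pose I : {pred R^o} := fun a => `[< exists y : 'rV_n, row_mx a%:M y \in K >].
have I_submod : submod_closed I.
  split; first by apply/asboolP; exists 0; rewrite raddf0 row_mx0.
  move=> c a a' /asboolP[y yK] /asboolP[y' y'K].
  apply/asboolP; exists (c *: y + y').
  have := KL c _ _ yK y'K.
  by rewrite scale_row_mx add_row_mx scale_scalar_mx -raddfD.
have [s sP] := noeR I I_submod.
pose K' : {pred 'rV[R]_n} := fun y => row_mx (0 : 'M_1) y \in K.
have K'_submod : submod_closed K'.
  split; first by rewrite unfold_in row_mx0.
  move=> c y y'; rewrite !unfold_in => yK y'K.
  have := KL c _ _ yK y'K.
  by rewrite scale_row_mx add_row_mx scaler0 addr0.
have [k [C' C'P]] := IHn K' K'_submod.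
(* Each generator of [I] is the first coordinate of a vector of [K]; that it
   lies in [I] is seen by taking a unit vector of coefficients. *)
have sI (i : 'I_(size s)) : exists y : 'rV_n, row_mx (s`_i)%:M y \in K.
  apply/asboolP; apply/(sP s`_i); exists (fun j => (j == i)%:R).
  rewrite (bigD1 i) //= eqxx mul1r big1 ?addr0 // => j /negPf->.
  by rewrite mul0r.
have [t tK] := choice sI.
pose D : 'M[R]_(size s, 1 + n) := \matrix_i row_mx (s`_i)%:M (t i).
have DK i : row i D \in K by rewrite rowK.
pose C : 'M[R]_(size s + k, 1 + n) := col_mx D (row_mx 0 C').
exists (size s + k)%N, C => x; split=> [xK|[r ->]]; last first.
  apply: Kmul => i; rewrite -[i]splitK; case: split => j /=.
    by rewrite /C rowKu.
  rewrite /C rowKd row_row_mx row0; apply/(C'P (row j C')).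
  by exists (delta_mx 0 j); rewrite -rowE.
rewrite -[x]hsubmxK in xK *; set a := lsubmx x in xK *.
have /sP[c cE] : a 0 0 \in I.
  by apply/asboolP; exists (rsubmx x); rewrite -mx11_scalar.
pose r := \row_i c i.
(* Subtracting the combination [r *m D] clears the first coordinate of [x];
   the rest is a combination of the rows of [C']. *)
have rDl : lsubmx (r *m D) = a.
  rewrite [a]mx11_scalar cE; apply/matrixP => i j; rewrite !ord1 !mxE eqxx.
  apply: eq_bigr => l _; rewrite !mxE.
  by case: split_ordP => // j' /eqP; rewrite eq_lshift ord1 ?eqxx ?mxE ?eqxx.
have /C'P[r' r'E] : rsubmx x - rsubmx (r *m D) \in K'.
  rewrite unfold_in -(subrr a) -{2}rDl -add_row_mx -opp_row_mx.
  rewrite (hsubmxK (r *m D)).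
  by apply: KD => //; rewrite -scaleN1r; apply/KZ/Kmul.
exists (row_mx r r'); rewrite mul_row_col mul_mx_row mulmx0 -r'E.
by rewrite -{1}[r *m D]hsubmxK add_row_mx addr0 rDl addrC subrK.
Qed.

(** * Flatness of the module of maps between injective modules *)

Lemma hom_sumE (R : comNzRingType) (M N : lmodType R) (I : Type) (s : seq I)
    (f : I -> {linear M -> N}) x :
  (\sum_(i <- s) f i) x = \sum_(i <- s) f i x.
Proof. exact: (big_morph (fun g : {linear M -> N} => g x)). Qed.

Lemma row_comb_linear (R : comNzRingType) (M : lmodType R) n (x : 'I_n -> M) :
  linear (fun r : 'rV[R]_n => \sum_i r 0 i *: x i).
Proof.
move=> c r r'; rewrite scaler_sumr -big_split; apply: eq_bigr => i _ /=.
by rewrite !mxE scalerDl scalerA.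
Qed.

Lemma mx_apply_linear (R : comNzRingType) (M : lmodType R) m n
    (C : 'M[R]_(m, n)) :
  linear (fun e : {ffun 'I_n -> M} => [ffun j => \sum_i C j i *: e i]).
Proof.
move=> c e e'; apply/ffunP => j; rewrite !ffunE scaler_sumr -big_split.
by apply: eq_bigr => i _; rewrite !ffunE /= scalerDr !scalerA mulrC.
Qed.

Lemma hom_comb_linear (R : comNzRingType) (M N : lmodType R) n
    (f : 'I_n -> {linear M -> N}) :
  linear (fun e : {ffun 'I_n -> M} => \sum_i f i (e i)).
Proof.
move=> c e e'; rewrite scaler_sumr -big_split; apply: eq_bigr => i _ /=.
by rewrite !ffunE linearP.
Qed.

Definition ffun_single (R : comNzRingType) (M : lmodType R) n (j : 'I_n)
    (x : M) : {ffun 'I_n -> M} :=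
  [ffun i => if i == j then x else 0].

Lemma ffun_single_linear (R : comNzRingType) (M : lmodType R) n (j : 'I_n) :
  linear (@ffun_single R M n j).
Proof.
move=> c x y; apply/ffunP => i; rewrite !ffunE; case: eqP => // _.
by rewrite scaler0 addr0.
Qed.

Lemma ffun_sum_single (R : comNzRingType) (M : lmodType R) n
    (e : {ffun 'I_n -> M}) : e = \sum_j @ffun_single R M n j (e j).
Proof.
apply/ffunP => i; rewrite sum_ffunE (bigD1 i) //= ffunE eqxx big1 ?addr0 //.
by move=> j ji; rewrite ffunE eq_sym (negPf ji).
Qed.

(** An equational criterion: the hypothesis says that the sum of the
    [x i (x) f i] vanishes as a functional on Hom(A, E), and the conclusion
    gives a reason for it to vanish already in the tensor product. *)
Lemma hom_injective_relation (R : comNzRingType) (A E E' : lmodType R) n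
    (x : 'I_n -> A) (f : 'I_n -> {linear E -> E'}) :
  noetherian R -> injective_module E -> injective_module E' ->
  (forall h : {linear A -> E}, \sum_i f i (h (x i)) = 0) ->
  exists m (C : 'M[R]_(m, n)) (g : 'I_m -> {linear E -> E'}),
    (forall j, \sum_i C j i *: x i = 0) /\
    (forall i, f i = \sum_j C j i *: g j).
Proof.
move=> noeR injE injE' f_vanish.
pose a := linear_of (row_comb_linear x).
have ker_submod : submod_closed [pred r | a r == 0].
  split=> [|c r r']; rewrite !inE ?raddf0 // linearP => /eqP-> /eqP->.
  by rewrite scaler0 addr0.
have [m [C kerC]] := noetherian_submod_row noeR ker_submod.
have Cx j : \sum_i C j i *: x i = 0.
  have /kerC/eqP ar0 : exists r, row j C = r *m C.
    by exists (delta_mx 0 j); rewrite -rowE.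
  by rewrite -[RHS]ar0; apply: eq_bigr => i _; rewrite mxE.
pose c := linear_of (@mx_apply_linear R E m n C).
(* A solution [e] of the system [C] prescribes a map on the span of the
   [x i], hence is the tuple of values of some [h : A -> E]. *)
have ker_c e : c e = 0 -> linear_of (hom_comb_linear f) e = 0.
  move=> ce0 /=.
  have ker_a r : a r = 0 -> linear_of (row_comb_linear e) r = 0.
    move=> /eqP/(kerC r)[s ->] /=.
    under eq_bigr => i _ do rewrite mxE scaler_suml.
    rewrite exchange_big big1 // => j _.
    under eq_bigr => i _ do rewrite -scalerA.
    have /ffunP/(_ j) := ce0; rewrite /= !ffunE => cej0.
    by rewrite -scaler_sumr cej0 scaler0.
  have [h hE] := injective_module_factor injE ker_a.
  rewrite -[RHS](f_vanish h); apply: eq_bigr => i _; congr (f i _).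
  have e1 (M : lmodType R) (y : 'I_n -> M) :
      \sum_k (delta_mx 0 i : 'rV[R]_n) 0 k *: y k = y i.
    rewrite (bigD1 i) //= mxE !eqxx scale1r big1 ?addr0 // => k /negPf ki.
    by rewrite mxE ki andbF scale0r.
  by have := hE (delta_mx 0 i); rewrite /= !e1.
have [g gE] := injective_module_factor injE' ker_c.
(* The maps sought are the components of [g] on the m copies of [E]. *)
exists m, C, (fun j => g \o linear_of (@ffun_single_linear R E m j)).
split=> // i; apply: linear_ext => y; rewrite hom_sumE.
have -> : f i y = g (c (ffun_single i y)).
  rewrite [g _]gE /= (bigD1 i) //= ffunE eqxx big1 ?addr0 // => k /negPf ki.
  by rewrite ffunE ki raddf0.
rewrite [c _]ffun_sum_single raddf_sum; apply: eq_bigr => j _ /=.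
rewrite -[RHS]linearZ; congr (g _); apply/ffunP => k; rewrite !ffunE.
case: (k == j); last by rewrite scaler0.
rewrite (bigD1 i) //= ffunE eqxx big1 ?addr0 // => l /negPf li.
by rewrite ffunE li scaler0.
Qed.

(** The relations found in [hom_injective_relation] hold in [A] itself, so the
    vanishing in [B (x) Hom(E, E')] descends to [A (x) Hom(E, E')]. *)
Lemma flat_hom_injective (R : comNzRingType) (E E' : lmodType R) :
  noetherian R -> injective_module E -> injective_module E' ->
  flat (dual E' E).
Proof.
move=> noeR injE injE' A B i i_inj u v uv.
suff ker0 w : tensor_map i (@idfun (dual E' E)) w = 0 -> w = 0.
  apply/eqP; rewrite -subr_eq0; apply/eqP/ker0.
  by rewrite linearB uv subrr.
have [s ->] := tensorE w.
rewrite big_tnth linear_sum => iu0.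
set x := fun k => (tnth (in_tuple s) k).1.
set f := fun k => (tnth (in_tuple s) k).2.
(* Evaluate the vanishing element of the tensor product over [B] at an
   extension [h'] of [h]. *)
have f_vanish (h : {linear A -> E}) : \sum_k f k (h (x k)) = 0.
  have [h' h'E] := injE _ _ i h i_inj.
  have ev_l (t : dual E' E) : linear (fun b => t (h' b)).
    by move=> c b b'; rewrite !linearP.
  have ev_r b : linear (fun t : dual E' E => t (h' b)) by [].
  have := congr1 (tensor_lift ev_l ev_r) iu0.
  rewrite linear_sum raddf0 => ev0; rewrite -[RHS]ev0; apply: eq_bigr => k _.
  by rewrite tensor_mapE tensor_liftE [h' _]h'E.
have [m [C [g [Cx fE]]]] :=
  hom_injective_relation noeR injE injE' f_vanish.
have tens_sumr (a : A) (I : finType) (t : I -> dual E' E) :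
    tens a (\sum_j t j) = \sum_j tens a (t j).
  exact: (linear_sum (linear_of (tens_linearr a))).
have tens_suml (t : dual E' E) (I : finType) (a : I -> A) :
    tens (\sum_j a j) t = \sum_j tens (a j) t.
  exact: (linear_sum (linear_of (fun c a => tens_linearl t c a))).
have tensZr c (a : A) (t : dual E' E) : tens a (c *: t) = c *: tens a t.
  exact: (linearZ_LR (linear_of (tens_linearr a))).
under eq_bigr => k _ do rewrite -/(x k) -/(f k) fE tens_sumr.
rewrite exchange_big big1 // => j _.
under eq_bigr => k _ do rewrite tensZr -tensZl.
rewrite -tens_suml Cx.
exact: (linear0 (linear_of (fun c a => tens_linearl (g j) c a))).
Qed.

(** * Lifting maps from flat modules *)

(** Under the adjunction between Hom and the tensor product, this is the
    extension of a map [N (x) G -> E'] along [N (x) G -> E (x) G]. *)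
Lemma flat_extend_hom (R : comNzRingType) (N E E' G : lmodType R)
    (i : {linear N -> E}) (h : {linear G -> dual E' N}) :
  injective i -> injective_module E' -> flat G ->
  exists g : {linear G -> dual E' E}, forall x, g x \o i =1 h x.
Proof.
move=> i_inj injE' flatG.
have ev_l (x : G) : linear (fun n : N => h x n).
  by move=> c n n'; rewrite linearP.
have ev_r (n : N) : linear (fun x : G => h x n).
  by move=> c x x'; rewrite linearP.
have [k kE] := injE' _ _ _ (tensor_lift ev_l ev_r) (flatG _ _ i i_inj).
have k_l (x : G) : linear (fun e : E => k (tens e x)).
  by move=> c e e'; rewrite tens_linearl linearP.
have k_r : linear (fun x => linear_of (k_l x) : dual E' E).
  by move=> c x x'; apply: linear_ext => e /=; rewrite tens_linearr linearP.
exists (linear_of k_r) => x n /=.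
have := kE (tens n x).
by rewrite tensor_liftE /comp tensor_mapE.
Qed.

Lemma dual_restriction_linear (R : comNzRingType) (N E E' : lmodType R)
    (i : {linear N -> E}) :
  linear (fun t : dual E' E => (t \o i : {linear N -> E'}) : dual E' N).
Proof. by move=> c t t'; apply: linear_ext. Qed.

Lemma flat_precover_dual (R : comNzRingType) (N E E' : lmodType R)
    (i : {linear N -> E}) :
  noetherian R -> injective i -> injective_module E -> injective_module E' ->
  flat_precover_of (dual E' E) (dual E' N).
Proof.
move=> noeR i_inj injE injE'; exists (linear_of (dual_restriction_linear i)).
split=> [|G flatG h]; first exact: flat_hom_injective.
have [g gE] := flat_extend_hom h i_inj injE' flatG.
by exists g => x; apply: linear_ext => n; apply: gE.
Qed.

Theorem theorem1p3 (R : comNzRingType) (m : idealr R) (p q : prime_idealr R)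
    (Ep Eq : lmodType R)
    (ip : {linear {ideal_quot p} -> Ep}) (iq : {linear {ideal_quot q} -> Eq})
    (hnoeth : noetherian R) (hloc : local_ring m)
    (hqp : {subset q <= p})
    (hp : injective_hull ip) (hq : injective_hull iq) :
  flat_precover_of (dual Ep Eq) (dual Ep {ideal_quot q}).
Proof.
have [_ injEp _] := hp; have [iq_inj injEq _] := hq.
exact: flat_precover_dual iq_inj injEq injEp.
Qed.
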